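(* Let $q:\mathbb R^{n+m}\to\mathbb R$ be a given function and let $\eta,\mu$ be non-negative scalars. (a) If $q$ is convex (respectively, strongly convex with modulus $\lambda_q$), then $q_{\eta,\mu}$ is also convex (respectively, strongly convex with the same modulus $\lambda_q$). (b) Assume that $q\in\mathcal C^i(\mathbb R^{n+m};L_{i,q})$ for a smoothness order $i\in\{0,1,2\}$. Then $q_{\eta,\mu}\in\mathcal C^i(\mathbb R^{n+m};L_{i,q})$ for the same smoothness order $i$.
   Context: $m,n\ge1$. Points are written $z=(x,y)\in\mathbb R^{n+m}$ with $x\in\mathbb R^n$, $y\in\mathbb R^m$. The Gaussian smoothing of $q$ is $$q_{\eta,\mu}(x,y)=\mathbb E_{u,v}[q(x+\eta u,y+\mu v)],$$ where $u\sim\mathcal N(0,I_n)$, $v\sim\mathcal N(0,I_m)$ are independent and the expectation is assumed to exist and be finite. $\mathcal C^i(S;L_{i,q})$ is the class of $i$ times differentiable functions whose $i$-th derivative ($q$ itself, $\nabla q$, $\nabla^2q$ for $i=0,1,2$) is Lipschitz on $S$ with constant $L_{i,q}$; norms are Euclidean for vectors and operator norms for matrices. Strong convexity with modulus $\lambda_q$ means $q(tz+(1-t)z')\le tq(z)+(1-t)q(z')-\frac{\lambda_q}{2}t(1-t)\|z-z'\|^2$ for all $z,z'$ and $t\in[0,1]$. *)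

(* Defs.v *)
From HB Require Import structures.
From mathcomp Require Import all_boot all_order all_algebra.
From mathcomp Require Import all_classical all_reals all_analysis.

Set Implicit Arguments.
Unset Strict Implicit.
Unset Printing Implicit Defensive.

Import Order.TTheory GRing.Theory Num.Theory.
Import numFieldNormedType.Exports.

Local Open Scope classical_set_scope.
Local Open Scope ring_scope.

Section standard_gaussian.
Variable R : realType.

Definition tcons n (p : measurableTypeR R * n.-tuple (measurableTypeR R)) :
  n.+1.-tuple (measurableTypeR R) :=
  [tuple of p.1 :: p.2].

Lemma measurable_tcons n : measurable_fun setT (@tcons n).
Proof. exact: measurable_cons. Qed.

HB.instance Definition _ n :=
  isMeasurableFun.Build _ _ _ _ (@tcons n) (@measurable_tcons n).

(* N(0, I_n), as the n-fold product of the one-dimensional N(0, 1).  It lives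
   on tuples because the library has no sigma-algebra on row vectors. *)
Fixpoint std_gaussian (n : nat) :
    probability (n.-tuple (measurableTypeR R)) R :=
  match n with
  | 0 => \d_([tuple] : 0.-tuple (measurableTypeR R))
  | n'.+1 => distribution (normal_prob 0 1 \x std_gaussian n')%E (@tcons n')
  end.

End standard_gaussian.

Section smoothing.
Variables (R : realType) (n m : nat).

Definition gaussian_pair :
    probability (n.-tuple (measurableTypeR R) *
                 m.-tuple (measurableTypeR R))%type R :=
  (std_gaussian R n \x std_gaussian R m)%E.

Definition row_of_tuple k (u : k.-tuple (measurableTypeR R)) : 'rV[R]_k :=
  \row_i tnth u i.

Definition perturbed (q : 'rV[R]_(n + m) -> R) (eta mu : R)
    (z : 'rV[R]_(n + m))
    (w : n.-tuple (measurableTypeR R) * m.-tuple (measurableTypeR R)) : R :=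
  q (row_mx (lsubmx z + eta *: row_of_tuple w.1)
            (rsubmx z + mu *: row_of_tuple w.2)).

Definition smoothable (q : 'rV[R]_(n + m) -> R) (eta mu : R) : Prop :=
  forall z, gaussian_pair.-integrable setT (EFin \o perturbed q eta mu z).

(* Meaningful under [smoothable q eta mu]: otherwise [fine] may send an
   infinite or undefined expectation to a junk value. *)
Definition smoothed (q : 'rV[R]_(n + m) -> R) (eta mu : R)
    (z : 'rV[R]_(n + m)) : R :=
  fine ('E_gaussian_pair[perturbed q eta mu z])%E.

End smoothing.

Section regularity.
Variables (R : realType) (k : nat).
Implicit Types (q : 'rV[R]_k -> R) (z v : 'rV[R]_k).

(* The norm [`|v|] that the library puts on matrices is the max norm. *)
Definition enorm v : R := Num.sqrt (\sum_i v 0 i ^+ 2).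

Definition opnorm (A : 'M[R]_k) : R :=
  sup [set enorm (v *m A) | v in [set v | enorm v <= 1]].

Definition strongly_convex (lambda : R) q : Prop :=
  forall (z z' : 'rV[R]_k) (t : R), 0 <= t <= 1 ->
    q (t *: z + (1 - t) *: z') <=
      t * q z + (1 - t) * q z'
      - lambda / 2 * t * (1 - t) * enorm (z - z') ^+ 2.

Definition gradient q z : 'rV[R]_k :=
  \row_i ('D_(delta_mx 0 i) (q : 'rV[R]_k -> R^o) z : R).

Definition hessian q z : 'M[R]_k := jacobian (gradient q) z.

(* [differentiable] is Frechet differentiability for the max norm, hence also
   for the Euclidean one. *)
Definition smooth_class (i : 'I_3) (L : R) q : Prop :=
  match val i with
  | 0 => forall z z', `|q z - q z'| <= L * enorm (z - z')
  | 1 => (forall z, differentiable (q : 'rV[R]_k -> R^o) z) /\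
         forall z z', enorm (gradient q z - gradient q z') <= L * enorm (z - z')
  | _ => (forall z, differentiable (q : 'rV[R]_k -> R^o) z) /\
         (forall z, differentiable (gradient q) z) /\
         forall z z', opnorm (hessian q z - hessian q z') <= L * enorm (z - z')
  end.

End regularity.

(* Main.v *)
Require Import Defs.
From HB Require Import structures.
From mathcomp Require Import all_boot all_order all_algebra.
From mathcomp Require Import all_classical all_reals all_analysis.
From mathcomp Require Import measurable_realfun.
From mathcomp Require Import ring lra.

(** The Gaussian smoothing of [q] is an average of translates of [q]: it sends
    [z] to the expectation of [q (z + s w)], where the law of [s w] does not
    depend on [z].  Averaging against a probability is linear and monotone and
    fixes constants, so every inequality that holds for all translates of [q]
    with a constant independent of the translation passes to the average.
    Convexity, strong convexity ([avg_convex]) and the Lipschitz bound on [q]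
    ([avg_lipschitz]) are inequalities of this kind.

    For the smooth classes, the same principle is applied to Taylor expansions.
    When the gradient of [q] is [L]-Lipschitz, the mean value theorem gives
    [`|q (z + h) - q z - dot (gradient q z) h| <= L * enorm h ^+ 2], uniformly
    in [z].  The uniform bound does two things.  The linear form
    [dot (gradient q z) h] is at bounded distance from [q (z + h) - q z], whose
    translates are integrable, so the gradient can be averaged
    (measurability holds since derivatives are limits of difference
    quotients).  And averaging the estimate yields a quadratic expansion of
    the average around every point, which proves that it is differentiable
    and that its gradient is the average of [gradient q].  Tested against a
    fixed vector, the averaged gradient then inherits the Lipschitz
    constant.

    When the Hessian is [L]-Lipschitz, the expansion has one more term and the
    error is [L * enorm h ^+ 3].  Integrability is recovered from the top down:
    the diagonal of the Hessian form from the second differences of [q]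
    ([averageable_hessian_form]), next the gradient from the first differences
    of [q] ([averageable_gradient]), and then all the entries of the Hessian
    from the first differences of the gradient ([averageable_hessian]).
    Averaging the expansions of [q] and of its gradient gives the two
    derivatives of the average ([avg_gradient], [avg_hessian]), and
    [avgm_lipschitz] bounds the oscillation of the second one. *)

Set Implicit Arguments.
Unset Strict Implicit.
Unset Printing Implicit Defensive.

Import Order.TTheory GRing.Theory Num.Theory.
Import numFieldNormedType.Exports.

Local Open Scope classical_set_scope.
Local Open Scope ring_scope.

(** * Euclidean norm and operator norm *)

Section euclidean.
Variables (R : realType) (k : nat).
Implicit Types (u v h z g : 'rV[R]_k) (A B : 'M[R]_k).

(** Squaring [enorm] gives [dot], so that norm bounds on averaged vectors and
    matrices can be proved on real-valued functions. *)
Definition dot u v : R := \sum_i u 0 i * v 0 i.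

Lemma dotC u v : dot u v = dot v u.
Proof. by apply: eq_bigr => i _; rewrite mulrC. Qed.

Lemma dotDl u u' v : dot (u + u') v = dot u v + dot u' v.
Proof. by rewrite -big_split; apply: eq_bigr => i _; rewrite mxE mulrDl. Qed.

Lemma dotZl c u v : dot (c *: u) v = c * dot u v.
Proof. by rewrite mulr_sumr; apply: eq_bigr => i _; rewrite mxE mulrA. Qed.

Lemma dotNl u v : dot (- u) v = - dot u v.
Proof. by rewrite -scaleN1r dotZl mulN1r. Qed.

Lemma dotNr u v : dot u (- v) = - dot u v.
Proof. by rewrite dotC dotNl dotC. Qed.

Lemma dotBl u u' v : dot (u - u') v = dot u v - dot u' v.
Proof. by rewrite dotDl dotNl. Qed.

Lemma dotZr c u v : dot u (c *: v) = c * dot u v.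
Proof. by rewrite dotC dotZl dotC. Qed.

Lemma dot_delta u i : dot u (delta_mx 0 i) = u 0 i.
Proof.
rewrite /dot (bigD1 i)//= mxE !eqxx mulr1 big1 ?addr0// => j ji.
by rewrite mxE (negbTE ji) mulr0.
Qed.

Lemma enorm_ge0 u : 0 <= enorm u. Proof. exact: sqrtr_ge0. Qed.

Lemma enorm_sqr u : enorm u ^+ 2 = dot u u.
Proof.
rewrite sqr_sqrtr; last by rewrite sumr_ge0// => i _; rewrite sqr_ge0.
by apply: eq_bigr => i _; rewrite expr2.
Qed.

Lemma enorm0 : enorm (0 : 'rV[R]_k) = 0.
Proof. by rewrite /enorm big1 ?sqrtr0// => i _; rewrite mxE expr0n. Qed.

Lemma enormZ c u : enorm (c *: u) = `|c| * enorm u.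
Proof.
apply/eqP; rewrite -(@eqrXn2 _ 2) ?mulr_ge0 ?enorm_ge0//; apply/eqP.
by rewrite exprMn !enorm_sqr dotZl dotZr mulrA -expr2 real_normK// num_real.
Qed.

Lemma enormN u : enorm (- u) = enorm u.
Proof. by rewrite -scaleN1r enormZ normrN1 mul1r. Qed.

Lemma CauchySchwarz_dot u v : `|dot u v| <= enorm u * enorm v.
Proof.
have [u0|u_neq0] := eqVneq (enorm u) 0.
  have uz i : u 0 i = 0.
    have : dot u u == 0 by rewrite -enorm_sqr u0 expr0n.
    rewrite psumr_eq0; last by move=> j _; rewrite -expr2 sqr_ge0.
    by move=> /allP/(_ i (mem_index_enum _)); rewrite mulf_eq0 orbb => /eqP.
  have -> : dot u v = 0 by rewrite /dot big1// => i _; rewrite uz mul0r.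
  by rewrite normr0 mulr_ge0 ?enorm_ge0.
have u_gt0 : 0 < enorm u by rewrite lt_def u_neq0 enorm_ge0.
rewrite -ler_sqr ?nnegrE ?mulr_ge0 ?enorm_ge0//.
rewrite real_normK ?num_real//.
(* [dot u v *: u - dot u u *: v] is [- dot u u] times the component of [v]
   orthogonal to [u]. *)
have := sqr_ge0 (enorm (dot u v *: u - dot u u *: v)).
rewrite enorm_sqr dotBl !(dotC _ (_ - _)) !dotBl.
rewrite !(dotZl, dotZr) (dotC v u) => H.
rewrite -(ler_pM2l (exprn_gt0 2 u_gt0)) -subr_ge0 exprMn !enorm_sqr.
by apply: le_trans H _; rewrite le_eqVlt; apply/orP; left; apply/eqP; ring.
Qed.

(** Taking [u := g] suffices.  This turns a bound on a vector-valued average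
    into bounds on scalar averages. *)
Lemma enorm_le_dual g (C : R) : 0 <= C ->
  (forall u, dot g u <= C * enorm u) -> enorm g <= C.
Proof.
move=> C0 /(_ g); rewrite -enorm_sqr expr2.
have [->|g0] := eqVneq (enorm g) 0; first by [].
by rewrite ler_pM2r// lt_def g0 enorm_ge0.
Qed.

Lemma normr_le_enorm u : `|u| <= enorm u.
Proof.
rewrite [leLHS]/Num.Def.normr/= mx_normrE bigmax_le ?enorm_ge0// => -[i j] _ /=.
rewrite ord1 -ler_sqr ?nnegrE ?enorm_ge0// real_normK ?num_real//.
rewrite enorm_sqr /dot (bigD1 j)//= -expr2 lerDl sumr_ge0// => l _.
by rewrite -expr2 sqr_ge0.
Qed.

Lemma enorm_le_normr u : enorm u <= Num.sqrt k%:R * `|u|.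
Proof.
rewrite -ler_sqr ?nnegrE ?mulr_ge0 ?enorm_ge0 ?sqrtr_ge0// exprMn enorm_sqr.
rewrite sqr_sqrtr// -[k%:R]mulr1 -[in k%:R](card_ord k) mulr_natl.
rewrite mulr_natl -sumr_const.
apply: ler_sum => i _; rewrite -expr2 -[leLHS]real_normK ?num_real//.
rewrite ler_sqr ?nnegrE//; rewrite [leRHS]/Num.Def.normr/= mx_normrE.
exact: (le_trans _ (le_bigmax _ _ (0, i))).
Qed.

(** Each column is bounded by Cauchy-Schwarz: the constant is the Frobenius
    norm.  Without such a bound [opnorm], a supremum, could be a junk value. *)
Lemma enorm_mul_bounded A : exists C, forall v, enorm (v *m A) <= C * enorm v.
Proof.
exists (Num.sqrt (\sum_j enorm (col j A)^T ^+ 2)) => v.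
rewrite -ler_sqr ?nnegrE ?mulr_ge0 ?enorm_ge0 ?sqrtr_ge0// exprMn.
rewrite enorm_sqr sqr_sqrtr.
  rewrite mulr_suml; apply: ler_sum => j _.
  have -> : (v *m A) 0 j = dot (col j A)^T v.
    by rewrite mxE dotC; apply: eq_bigr => i _; rewrite !mxE.
  rewrite -expr2 -exprMn -[leLHS]real_normK ?num_real//.
  by rewrite ler_sqr ?nnegrE ?mulr_ge0 ?enorm_ge0// CauchySchwarz_dot.
by rewrite sumr_ge0// => j _; rewrite sqr_ge0.
Qed.

Lemma opnorm_has_ubound A :
  has_ubound [set enorm (v *m A) | v in [set v | enorm v <= 1]].
Proof.
have [C HC] := enorm_mul_bounded A.
exists `|C| => _ [u /= u1 <-]; apply: (le_trans (HC u)).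
apply: (@le_trans _ _ (`|C| * enorm u)).
  by rewrite ler_wpM2r ?enorm_ge0 ?ler_norm.
by rewrite ler_piMr.
Qed.

Lemma opnorm_ge0 A : 0 <= opnorm A.
Proof.
apply: ub_le_sup; first exact: opnorm_has_ubound.
by exists 0; rewrite /= ?mul0mx enorm0.
Qed.

Lemma enorm_mul_opnorm A v : enorm (v *m A) <= opnorm A * enorm v.
Proof.
have [v0|v_neq0] := eqVneq (enorm v) 0.
  by have [C /(_ v)] := enorm_mul_bounded A; rewrite v0 !mulr0.
have v_gt0 : 0 < enorm v by rewrite lt_def v_neq0 enorm_ge0.
rewrite -ler_pdivrMr//.
have -> : enorm (v *m A) / enorm v = enorm ((enorm v)^-1 *: v *m A).
  by rewrite -scalemxAl enormZ ger0_norm ?invr_ge0 ?enorm_ge0// mulrC.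
apply: ub_le_sup; first exact: opnorm_has_ubound.
exists ((enorm v)^-1 *: v) => //=.
by rewrite enormZ ger0_norm ?invr_ge0 ?enorm_ge0// mulVf.
Qed.

Lemma opnorm_le_dual A (C : R) : 0 <= C ->
  (forall u v, dot (v *m A) u <= C * enorm v * enorm u) -> opnorm A <= C.
Proof.
move=> C0 HA; apply: ge_sup.
  by exists (enorm (0 *m A)), 0 => //=; rewrite enorm0.
move=> _ [v /= v1 <-]; apply: (@le_trans _ _ (C * enorm v)).
  by apply: enorm_le_dual => // ; rewrite mulr_ge0 ?enorm_ge0.
by rewrite ler_piMr.
Qed.

End euclidean.

(** * Derivatives along lines and from quadratic expansions *)

(** A quadratic remainder is a little-o of the increment, and a differential is
    determined by its first-order expansion. *)
Lemma quadratic_expansion_diff (R : realType) (V W : normedModType R)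
    (f : V -> W) (df : {linear V -> W}) z (C r : R) : 0 <= C -> 0 < r ->
  continuous df ->
  (forall h, `|h| <= r -> `|f (z + h) - f z - df h| <= C * `|h| ^+ 2) ->
  differentiable f z /\ 'd f z = df :> (V -> W).
Proof.
move=> C0 r0 dfc fC.
have fdf : f \o shift z = cst (f z) + df +o_ 0 id.
  apply/eqaddoP => _/posnumP[e]; near=> h.
  have hr : `|h| <= r by near: h; exact: nbhs0_le.
  have : `|h| <= e%:num / (C + 1).
    by near: h; apply: nbhs0_le; rewrite divr_gt0//; lra.
  rewrite ler_pdivlMr => [he|]; last lra.
  rewrite -[X in `|X|]/(f (h + z) - (f z + df h)) opprD addrA [h + z]addrC.
  apply: (le_trans (fC h hr)); rewrite expr2 mulrA ler_wpM2r//.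
  by have := normr_ge0 h; nra.
have dE := diff_unique dfc fdf; split=> //.
by apply/diff_locallyP; rewrite dE.
Unshelve. all: by end_near. Qed.

Section derivatives.
Variables (R : realType) (k : nat).
Implicit Types (u v h z g : 'rV[R]_k) (A H : 'M[R]_k) (q : 'rV[R]_k -> R).

Lemma linear_enorm_continuous (W : normedModType R)
    (df : {linear 'rV[R]_k -> W}) (K : R) :
  (forall h, `|df h| <= K * enorm h) -> continuous df.
Proof.
move=> dfK; apply/bounded_linear_continuous/linear_boundedP.
near=> r => h; apply: (le_trans (dfK h)).
apply: (@le_trans _ _ (`|K| * (Num.sqrt k%:R * `|h|))).
  apply: (@le_trans _ _ (`|K| * enorm h)).
    by rewrite ler_wpM2r ?enorm_ge0 ?ler_norm.
  by rewrite ler_wpM2l ?enorm_le_normr.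
by rewrite mulrA ler_wpM2r.
Unshelve. all: by end_near. Qed.

(** The same criterion in Euclidean terms: the two norms are equivalent, with
    constants [1] and [Num.sqrt k%:R]. *)
Lemma quadratic_expansion_diff_enorm (W : normedModType R)
    (f : 'rV[R]_k -> W) (df : {linear 'rV[R]_k -> W}) z (K C : R) : 0 <= C ->
  (forall h, `|df h| <= K * enorm h) ->
  (forall h, enorm h <= 1 -> `|f (z + h) - f z - df h| <= C * enorm h ^+ 2) ->
  differentiable f z /\ 'd f z = df :> (_ -> _).
Proof.
move=> C0 dfK fC; set M := Num.sqrt k%:R : R.
have M0 : 0 <= M by exact: sqrtr_ge0.
have hM h : enorm h <= M * `|h| := enorm_le_normr h.
apply: (@quadratic_expansion_diff R _ W f df z (C * M ^+ 2) (M + 1)^-1).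
- by rewrite mulr_ge0 ?sqr_ge0.
- by rewrite invr_gt0; lra.
- exact: linear_enorm_continuous dfK.
move=> h; rewrite -(ler_pM2l (_ : 0 < M + 1)); last lra.
rewrite mulfV; last by rewrite lt0r_neq0//; lra.
move=> h1; have hM1 : M * `|h| <= 1 by have := normr_ge0 h; nra.
apply: (le_trans (fC h (le_trans (hM h) hM1))).
rewrite -mulrA -exprMn ler_wpM2l// ler_sqr ?nnegrE ?enorm_ge0//.
by rewrite mulr_ge0.
Qed.

Lemma derive_gradient q z h : differentiable (q : 'rV[R]_k -> R^o) z ->
  'D_h (q : 'rV[R]_k -> R^o) z = dot (gradient q z) h.
Proof.
move=> qz; rewrite deriveE// [in LHS](row_sum_delta h) linear_sum.
apply: eq_bigr => i _; rewrite linearZ mxE deriveE//.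
by rewrite mulrC.
Qed.

(** [dot] with its second argument fixed, named so that it can carry a
    linear structure. *)
Definition dotr u v : R^o := dot v u.

Fact dotr_linear u : linear (dotr u).
Proof. by move=> a v w; rewrite /dotr dotDl dotZl. Qed.

HB.instance Definition _ u :=
  GRing.isLinear.Build R 'rV[R]_k R^o _ (dotr u) (dotr_linear u).

Lemma dotr_continuous u : continuous (dotr u).
Proof.
apply: (@linear_enorm_continuous R^o _ (enorm u)) => v.
by rewrite mulrC; exact: CauchySchwarz_dot.
Qed.

Lemma gradient_expansion q z g (C : R) : 0 <= C ->
  (forall h, enorm h <= 1 ->
    `|q (z + h) - q z - dot g h| <= C * enorm h ^+ 2) ->
  differentiable (q : 'rV[R]_k -> R^o) z /\ gradient q z = g.
Proof.
move=> C0 qC.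
have [||qz dq] := @quadratic_expansion_diff_enorm R^o q
    (dotr g) z (enorm g) C C0.
- by move=> h; rewrite mulrC; exact: CauchySchwarz_dot.
- by move=> h /qC; rewrite /= /dotr dotC.
split=> //; apply/rowP => i; rewrite mxE deriveE// dq.
by rewrite /= /dotr dotC dot_delta.
Qed.

Lemma jacobian_expansion (F : 'rV[R]_k -> 'rV[R]_k) z A (C : R) : 0 <= C ->
  (forall h, enorm (F (z + h) - F z - h *m A) <= C * enorm h ^+ 2) ->
  differentiable F z /\ jacobian F z = A.
Proof.
move=> C0 FC.
have [||Fz dF] :=
  @quadratic_expansion_diff_enorm _ F (mulmxr A) z (opnorm A) C C0.
- move=> h; apply: (le_trans (normr_le_enorm _)); exact: enorm_mul_opnorm.
- by move=> h _; apply: (le_trans (normr_le_enorm _)); exact: FC.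
split=> //; apply/row_matrixP => i; rewrite !rowE /jacobian mul_rV_lin1.
by rewrite dF.
Qed.

(** The difference quotients of [f] along the line are those of [f] in the
    direction [h]. *)
Lemma is_derive_line (W : normedModType R) (f : 'rV[R]_k -> W) z h (t : R) :
  derivable f (z + t *: h) h ->
  is_derive t 1 (fun r : R => f (z + r *: h)) ('D_h f (z + t *: h)).
Proof.
move=> df.
have E : (fun r : R => r^-1 *: (((fun r : R => f (z + r *: h)) \o shift t)
    (r *: (1 : R^o)) - f (z + t *: h))) =
    (fun r : R => r^-1 *: ((f \o shift (z + t *: h)) (r *: h) -
      f (z + t *: h))).
  apply/funext => r /=; congr (_ *: (f _ - _)).
  by rewrite scalerDl -[r *: 1]/(r * 1) mulr1 addrCA.
by split; rewrite /derivable /derive E.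
Qed.

Lemma is_derive_dot (V : normedModType R) (F : V -> 'rV[R]_k) (x v : V)
    (dF : 'rV[R]_k) u : is_derive x v F dF ->
  is_derive x v (fun y => dot (F y) u : R^o) (dot dF u).
Proof.
move=> [Fx <-].
have Fcv : r^-1 *: (dot ((F \o shift x) (r *: v)) u - dot (F x) u : R^o)
    @[r --> 0^'] --> (dot ('D_v F x) u : R^o).
  have -> : (fun r : R => r^-1 *: (dot ((F \o shift x) (r *: v)) u -
      dot (F x) u : R^o)) =
      dotr u \o
      (fun r : R => r^-1 *: ((F \o shift x) (r *: v) - F x)).
    by apply/funext => r; rewrite /= /dotr dotZl dotBl.
  by apply: cvg_comp; [exact: Fx | exact: dotr_continuous].
split; last exact/cvg_lim.
by apply/cvg_ex; exists (dot ('D_v F x) u).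
Qed.

Lemma MVT_unit (f df : R -> R) : (forall t : R, is_derive t 1 f (df t)) ->
  exists2 c : R, 0 <= c <= 1 & f 1 - f 0 = df c.
Proof.
move=> fdf; have fc : {within `[0, 1], continuous f}.
  by apply: derivable_within_continuous => t _; case: (fdf t).
have [c c01 fE] := MVT_segment ler01 (fun t _ => fdf t) fc.
by exists c; [rewrite in_itv in c01|rewrite fE subr0 mulr1].
Qed.

End derivatives.

(** * Taylor estimates with Lipschitz derivatives *)

Section taylor.
Variables (R : realType) (k : nat) (L : R).
Hypothesis L_ge0 : 0 <= L.
Implicit Types (u v h z g : 'rV[R]_k) (q : 'rV[R]_k -> R).

Lemma enormZ_le (c : R) h : 0 <= c <= 1 -> enorm (c *: h) <= enorm h.
Proof.
by move=> /andP[c0 c1]; rewrite enormZ ger0_norm// ler_piMl// enorm_ge0.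
Qed.

Lemma is_derive_line_gradient q z h (t : R) :
  (forall z, differentiable (q : 'rV[R]_k -> R^o) z) ->
  is_derive t 1 (fun r : R => q (z + r *: h) : R^o)
    (dot (gradient q (z + t *: h)) h).
Proof.
move=> dq; rewrite -derive_gradient//.
by apply: (is_derive_line (f := q : 'rV[R]_k -> R^o)); exact: diff_derivable.
Qed.

(** By the mean value theorem the remainder is
    [dot (gradient q (z + c *: h) - gradient q z) h] with [c] in the unit
    interval; the constant [L] instead of [L / 2] is good enough. *)
Lemma gradient_lipschitz_taylor q z h :
  (forall z, differentiable (q : 'rV[R]_k -> R^o) z) ->
  (forall z z', enorm (gradient q z - gradient q z') <= L * enorm (z - z')) ->
  `|q (z + h) - q z - dot (gradient q z) h| <= L * enorm h ^+ 2.
Proof.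
move=> dq lip.
have [c c01] := MVT_unit (fun t => is_derive_line_gradient z h t dq).
rewrite scale1r scale0r addr0 => ->; rewrite -dotBl.
apply: (le_trans (CauchySchwarz_dot _ _)).
rewrite expr2 mulrA ler_wpM2r ?enorm_ge0//.
apply: (le_trans (lip _ _)); rewrite ler_wpM2l//.
by rewrite addrAC subrr add0r enormZ_le.
Qed.

(** The mean value theorem fails for vector-valued maps, so it is applied to
    [dot (F _) u] for each [u], and duality concludes. *)
Lemma jacobian_lipschitz_taylor (F : 'rV[R]_k -> 'rV[R]_k) z h :
  (forall z, differentiable F z) ->
  (forall z z', opnorm (jacobian F z - jacobian F z') <= L * enorm (z - z')) ->
  enorm (F (z + h) - F z - h *m jacobian F z) <= L * enorm h ^+ 2.
Proof.
move=> dF lip; apply: enorm_le_dual => [|u].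
  by rewrite mulr_ge0 ?sqr_ge0.
have dFu (t : R) : is_derive t 1 (fun r : R => dot (F (z + r *: h)) u : R^o)
    (dot (h *m jacobian F (z + t *: h)) u).
  rewrite -deriveEjacobian//; apply: is_derive_dot; apply: is_derive_line.
  exact: diff_derivable.
have [c c01] := MVT_unit dFu.
rewrite scale1r scale0r addr0 dotBl dotBl => ->; rewrite -dotBl -mulmxBr.
apply: (le_trans (ler_norm _)); apply: (le_trans (CauchySchwarz_dot _ _)).
rewrite ler_wpM2r ?enorm_ge0//; apply: (le_trans (enorm_mul_opnorm _ _)).
rewrite expr2 mulrA ler_wpM2r ?enorm_ge0//.
apply: (le_trans (lip _ _)); rewrite ler_wpM2l//.
by rewrite addrAC subrr add0r enormZ_le.
Qed.

(** Subtracting the quadratic term from [q] along the line before using the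
    mean value theorem makes the first-order remainder of the gradient appear,
    which [jacobian_lipschitz_taylor] bounds. *)
Lemma hessian_lipschitz_taylor q z h :
  (forall z, differentiable (q : 'rV[R]_k -> R^o) z) ->
  (forall z, differentiable (gradient q) z) ->
  (forall z z', opnorm (hessian q z - hessian q z') <= L * enorm (z - z')) ->
  `|q (z + h) - q z - dot (gradient q z) h - 2^-1 * dot (h *m hessian q z) h|
    <= L * enorm h ^+ 3.
Proof.
move=> dq ddq lip; set a := dot (h *m hessian q z) h.
have dpsi (t : R) :
    is_derive t 1 (fun r : R => q (z + r *: h) - 2^-1 * a * r ^+ 2)
      (dot (gradient q (z + t *: h)) h - t * a).
  have -> : (fun r : R => q (z + r *: h) - 2^-1 * a * r ^+ 2) =
      (fun r : R => q (z + r *: h)) - (2^-1 * a) \*: ((@id R) ^+ 2).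
    by apply/funext => r.
  have dqt := is_derive_line_gradient z h t dq.
  apply: is_derive_eq; rewrite -[X in _ - X]/(_ * (_ * _)).
  rewrite expr1 mulr1; lra.
have [c c01] := MVT_unit dpsi.
rewrite scale1r scale0r addr0 expr1n expr0n/= mulr0 subr0 mulr1 => qE.
have {qE} -> : q (z + h) - q z - dot (gradient q z) h - 2^-1 * a =
    dot (gradient q (z + c *: h) - gradient q z - c *: h *m hessian q z) h.
  rewrite !dotBl -scalemxAl dotZl -/a; lra.
apply: (le_trans (CauchySchwarz_dot _ _)).
rewrite exprSr mulrA ler_wpM2r ?enorm_ge0//.
apply: (le_trans (jacobian_lipschitz_taylor _ _ ddq lip)).
rewrite ler_wpM2l// ler_sqr ?nnegrE ?enorm_ge0//; exact: enormZ_le.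
Qed.

End taylor.

(** * Averaging over random translations *)

Section averaging.
Variables (R : realType) (k : nat) (d : measure_display) (T : measurableType d).
Variables (P : probability T R) (s : T -> 'rV[R]_k).
Implicit Types (u v h z : 'rV[R]_k) (f g q : 'rV[R]_k -> R).

Definition averageable f :=
  forall z, P.-integrable setT (EFin \o (fun w => f (z + s w))).

Definition avg f z : R := \int[P]_w f (z + s w).

Lemma averageable_measurable f z :
  averageable f -> measurable_fun setT (fun w => f (z + s w)).
Proof. by move=> /(_ z)/integrableP[/measurable_EFinP]. Qed.

Lemma averageable_shift f h : averageable f -> averageable (fun z => f (z + h)).
Proof.
move=> fi z; have := fi (z + h); apply: eq_integrable => // w _ /=.
by rewrite addrAC.
Qed.

Lemma avg_shift f h z : avg (fun z => f (z + h)) z = avg f (z + h).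
Proof. by apply: eq_Rintegral => w _; rewrite addrAC. Qed.

Lemma averageableD f g :
  averageable f -> averageable g -> averageable (fun z => f z + g z).
Proof. by move=> fi gi z; exact: (integrableD measurableT (fi z) (gi z)). Qed.

Lemma averageableB f g :
  averageable f -> averageable g -> averageable (fun z => f z - g z).
Proof. by move=> fi gi z; exact: (integrableB measurableT (fi z) (gi z)). Qed.

Lemma averageableZ c f : averageable f -> averageable (fun z => c * f z).
Proof. by move=> fi z; exact: (integrableZl measurableT c (fi z)). Qed.

Lemma averageable_cst c : averageable (fun=> c).
Proof. by move=> z; exact: finite_measure_integrable_cst. Qed.

Lemma avgD f g z : averageable f -> averageable g ->
  avg (fun z => f z + g z) z = avg f z + avg g z.
Proof. by move=> fi gi; exact: (RintegralD measurableT (fi z) (gi z)). Qed.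

Lemma avgB f g z : averageable f -> averageable g ->
  avg (fun z => f z - g z) z = avg f z - avg g z.
Proof. by move=> fi gi; exact: (RintegralB measurableT (fi z) (gi z)). Qed.

Lemma avgZ c f z : averageable f -> avg (fun z => c * f z) z = c * avg f z.
Proof. by move=> fi; rewrite /avg RintegralZl//; exact: fi. Qed.

Lemma avg_cst c z : avg (fun=> c) z = c.
Proof.
by rewrite /avg Rintegral_cst// [X in fine X](probability_setT P) mulr1.
Qed.

Lemma averageable_sum (I : eqType) (r : seq I) (f : I -> 'rV[R]_k -> R) :
  (forall i, averageable (f i)) -> averageable (fun z => \sum_(i <- r) f i z).
Proof.
move=> fi; elim: r => [|i r IHr] z.
  apply: eq_integrable (averageable_cst 0 z) => // w _ /=.
  by rewrite big_nil.
apply: eq_integrable (averageableD (fi i) IHr z) => // w _ /=.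
by rewrite big_cons.
Qed.

Lemma avg_sum (I : eqType) (r : seq I) (f : I -> 'rV[R]_k -> R) z :
  (forall i, averageable (f i)) ->
  avg (fun z => \sum_(i <- r) f i z) z = \sum_(i <- r) avg (f i) z.
Proof.
move=> fi; elim: r => [|i r IHr].
  rewrite big_nil -[RHS](avg_cst 0 z).
  by apply: eq_Rintegral => w _ /=; rewrite big_nil.
rewrite big_cons -IHr -avgD//; last exact: averageable_sum.
by apply: eq_Rintegral => w _ /=; rewrite big_cons.
Qed.

Lemma le_avg f g z : averageable f -> averageable g ->
  (forall z, f z <= g z) -> avg f z <= avg g z.
Proof. by move=> fi gi fg; apply: le_Rintegral => // w _; exact: fg. Qed.

Lemma normr_avg_le f (C : R) z : averageable f ->
  (forall z, `|f z| <= C) -> `|avg f z| <= C.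
Proof.
move=> fi fC; have fC2 y : - C <= f y <= C by rewrite -ler_norml.
rewrite ler_norml; apply/andP; split.
  rewrite -[leLHS](avg_cst _ z); apply: le_avg => // [|y].
    exact: averageable_cst.
  by case/andP: (fC2 y).
rewrite -[leRHS](avg_cst _ z); apply: le_avg => // [|y].
  exact: averageable_cst.
by case/andP: (fC2 y).
Qed.

(** This is how integrability passes from a function to its derivatives: [g] is
    a finite difference and the bound a Taylor estimate. *)
Lemma averageable_near f g (C : R) :
  (forall z, measurable_fun setT (fun w => f (z + s w))) -> averageable g ->
  (forall z, `|f z - g z| <= C) -> averageable f.
Proof.
move=> fm gi fg z.
have gCi : P.-integrable setT (EFin \o (fun w => `|g (z + s w)| + C)).
  exact: (integrableD measurableT (integrable_norm (gi z))
    (averageable_cst C z)).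
apply: le_integrable gCi => //; first by apply/measurable_EFinP; exact: fm.
move=> w _ /=; rewrite lee_fin [leRHS]ger0_norm; last first.
  by rewrite addr_ge0// (le_trans _ (fg z)).
rewrite -[f _](subrK (g (z + s w))) addrC.
by rewrite (le_trans (ler_normD _ _))// lerD2l.
Qed.

(** A derivative is the limit of a sequence of difference quotients. *)
Lemma measurable_avg_derive f h :
  (forall z, measurable_fun setT (fun w => f (z + s w))) ->
  (forall z, derivable (f : 'rV[R]_k -> R^o) z h) ->
  forall z, measurable_fun setT
    (fun w => 'D_h (f : 'rV[R]_k -> R^o) (z + s w) : R).
Proof.
move=> fm fd z.
pose t n : R := (n.+1%:R)^-1.
pose X n w : R := (t n)^-1 * (f (z + t n *: h + s w) - f (z + s w)).
apply: (measurable_fun_cvg (h := X)) => [n|w _].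
  by apply: measurable_funM => //; apply: measurable_funB.
have -> : X ^~ w = fun n =>
    (t n)^-1 *: ((f \o shift (z + s w)) (t n *: h) - f (z + s w) : R^o).
  by apply/funext => n; rewrite /X /= addrAC (addrC _ (_ *: h)).
have /cvgr_dnbhsP := fd (z + s w).
by apply; split=> [n|]; [rewrite invr_neq0|exact: cvg_harmonic].
Qed.

Definition avgv (F : 'rV[R]_k -> 'rV[R]_k) z : 'rV[R]_k :=
  \row_i avg (fun z => F z 0 i) z.

Definition avgm (A : 'rV[R]_k -> 'M[R]_k) z : 'M[R]_k :=
  \matrix_(i, j) avg (fun z => A z i j) z.

Lemma eq_avg f g z : f =1 g -> avg f z = avg g z.
Proof. by move=> fg; apply: eq_Rintegral => w _; rewrite fg. Qed.

Lemma eq_averageable f g : f =1 g -> averageable f -> averageable g.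
Proof. by move=> /funext ->. Qed.

Lemma dot_avgv (F : 'rV[R]_k -> 'rV[R]_k) z u :
  (forall v, averageable (fun z => dot (F z) v)) ->
  dot (avgv F z) u = avg (fun z => dot (F z) u) z.
Proof.
move=> Fi; have Fi0 i : averageable (fun z => F z 0 i).
  by apply: eq_averageable (Fi (delta_mx 0 i)) => y; rewrite dot_delta.
rewrite /dot avg_sum => [|i]; last first.
  apply: eq_averageable (averageableZ (u 0 i) (Fi0 i)) => y; exact: mulrC.
apply: eq_bigr => i _; rewrite mxE mulrC -avgZ//.
by apply: eq_avg => y; exact: mulrC.
Qed.

Lemma dot_mul_avgm (A : 'rV[R]_k -> 'M[R]_k) z h u :
  (forall v w, averageable (fun z => dot (v *m A z) w)) ->
  dot (h *m avgm A z) u = avg (fun z => dot (h *m A z) u) z.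
Proof.
move=> Ai; have Ai0 i j : averageable (fun z => A z i j).
  apply: eq_averageable (Ai (delta_mx 0 i) (delta_mx 0 j)) => y.
  by rewrite dot_delta -rowE mxE.
have <- : avgv (fun z => h *m A z) z = h *m avgm A z.
  apply/rowP => j; rewrite !mxE; under eq_avg do rewrite mxE.
  rewrite avg_sum => [|i]; last exact: averageableZ.
  by apply: eq_bigr => i _; rewrite mxE avgZ.
by rewrite dot_avgv.
Qed.

End averaging.

(** * Averaging preserves convexity and smoothness *)

Section averaging_regularity.
Variables (R : realType) (k : nat) (d : measure_display) (T : measurableType d).
Variables (P : probability T R) (s : T -> 'rV[R]_k).
Implicit Types (u v h z : 'rV[R]_k) (f g q : 'rV[R]_k -> R).

Local Notation averageable := (averageable P s).
Local Notation avg := (avg P s).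
Local Notation avgv := (avgv P s).
Local Notation avgm := (avgm P s).

(** [C] stands for the strong convexity defect, which depends on the two points
    through [z - z'] only and is thus the same for all translates. *)
Lemma avg_convex q (t C : R) z z' : averageable q ->
  (forall y, q (t *: (z + y) + (1 - t) *: (z' + y)) <=
     t * q (z + y) + (1 - t) * q (z' + y) - C) ->
  avg q (t *: z + (1 - t) *: z') <= t * avg q z + (1 - t) * avg q z' - C.
Proof.
move=> qi qC.
have shift x : avg q x = avg (fun y => q (y + x)) 0 by rewrite avg_shift add0r.
have qxi x : averageable (fun y => q (y + x)) by exact: averageable_shift.
rewrite !shift -!avgZ// -avgD//; [|exact: averageableZ..].
rewrite -[C in leRHS](avg_cst P s C 0) -avgB; last first.
- exact: averageable_cst.
- by apply: averageableD; exact: averageableZ.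
apply: le_avg => // [|y].
  apply: averageableB; last exact: averageable_cst.
  by apply: averageableD; exact: averageableZ.
rewrite (addrC y z) (addrC y z'); apply: le_trans (qC y).
rewrite !scalerDr addrACA -scalerDl (addrC t) subrK scale1r.
by rewrite [y + _]addrC.
Qed.

Lemma avg_lipschitz q (L : R) : averageable q ->
  (forall z z', `|q z - q z'| <= L * enorm (z - z')) ->
  forall z z', `|avg q z - avg q z'| <= L * enorm (z - z').
Proof.
move=> qi lip z z'.
have shift x : avg q x = avg (fun y => q (y + x)) 0 by rewrite avg_shift add0r.
have qxi x : averageable (fun y => q (y + x)) by exact: averageable_shift.
rewrite !shift -avgB//; apply: normr_avg_le => [|y].
  exact: averageableB.
by apply: (le_trans (lip _ _)); rewrite opprD addrACA subrr add0r.
Qed.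

(** [avg_lipschitz] applied to [dot (F _) u] gives the constant
    [L * enorm u] for every [u]. *)
Lemma avgv_lipschitz (F : 'rV[R]_k -> 'rV[R]_k) (L : R) :
  0 <= L -> (forall u, averageable (fun z => dot (F z) u)) ->
  (forall z z', enorm (F z - F z') <= L * enorm (z - z')) ->
  forall z z', enorm (avgv F z - avgv F z') <= L * enorm (z - z').
Proof.
move=> L0 Fi lip z z'; apply: enorm_le_dual => [|u].
  by rewrite mulr_ge0 ?enorm_ge0.
rewrite dotBl !dot_avgv//; apply: le_trans (ler_norm _) _.
rewrite mulrAC; apply: avg_lipschitz => // {}z {}z'; rewrite -dotBl mulrAC.
apply: le_trans (CauchySchwarz_dot _ _) _.
by rewrite ler_wpM2r ?enorm_ge0.
Qed.

Lemma avgm_lipschitz (A : 'rV[R]_k -> 'M[R]_k) (L : R) :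
  0 <= L -> (forall v u, averageable (fun z => dot (v *m A z) u)) ->
  (forall z z', opnorm (A z - A z') <= L * enorm (z - z')) ->
  forall z z', opnorm (avgm A z - avgm A z') <= L * enorm (z - z').
Proof.
move=> L0 Ai lip z z'; apply: opnorm_le_dual => [|u v].
  by rewrite mulr_ge0 ?enorm_ge0.
rewrite mulmxBr dotBl !dot_mul_avgm//; apply: le_trans (ler_norm _) _.
rewrite [leRHS](_ : _ = L * enorm v * enorm u * enorm (z - z')); last by ring.
apply: (avg_lipschitz (q := fun z => dot (v *m A z) u)) => // {}z {}z'.
rewrite -dotBl -mulmxBr; apply: le_trans (CauchySchwarz_dot _ _) _.
rewrite [leRHS](_ : _ = L * enorm (z - z') * enorm v * enorm u); last by ring.
rewrite ler_wpM2r ?enorm_ge0//; apply: le_trans (enorm_mul_opnorm _ _) _.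
by rewrite ler_wpM2r ?enorm_ge0.
Qed.

Section differentiable_integrand.
Variables (q : 'rV[R]_k -> R) (L : R).
Hypotheses (L_ge0 : 0 <= L) (qi : averageable q).
Hypothesis dq : forall z, differentiable (q : 'rV[R]_k -> R^o) z.

Lemma measurable_dot_gradient h z :
  measurable_fun setT (fun w => dot (gradient q (z + s w)) h).
Proof.
under eq_fun do rewrite -derive_gradient//.
apply: measurable_avg_derive => {}z; last exact: diff_derivable.
exact: averageable_measurable.
Qed.

Section lipschitz_gradient.
Hypothesis lip :
  forall z z', enorm (gradient q z - gradient q z') <= L * enorm (z - z').

(** The linear term is a first difference of [q] up to a bounded error. *)
Lemma averageable_lipschitz_gradient h :
  averageable (fun z => dot (gradient q z) h).
Proof.
apply: (@averageable_near _ _ _ _ _ _ _ (fun z => q (z + h) - q z)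
    (L * enorm h ^+ 2)) => [z||z].
- exact: measurable_dot_gradient.
- by apply: averageableB => //; exact: averageable_shift.
- by rewrite distrC; exact: gradient_lipschitz_taylor.
Qed.

Lemma avg_lipschitz_gradient z :
  differentiable (avg q : 'rV[R]_k -> R^o) z /\
  gradient (avg q) z = avgv (gradient q) z.
Proof.
apply: (gradient_expansion L_ge0) => h _.
have gi := averageable_lipschitz_gradient.
have qhi : averageable (fun y => q (y + h)) by exact: averageable_shift.
rewrite dot_avgv// -avg_shift -!avgB//; last exact: averageableB.
apply: normr_avg_le => [|y].
  by do 2 apply: averageableB => //.
exact: gradient_lipschitz_taylor.
Qed.

End lipschitz_gradient.

Section lipschitz_hessian.
Hypothesis ddq : forall z, differentiable (gradient q) z.
Hypothesis lip :
  forall z z', opnorm (hessian q z - hessian q z') <= L * enorm (z - z').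

Lemma measurable_dot_hessian u h z :
  measurable_fun setT (fun w => dot (h *m hessian q (z + s w)) u).
Proof.
have dE y : is_derive y h (fun z => dot (gradient q z) u : R^o)
    (dot (h *m hessian q y) u).
  rewrite -deriveEjacobian//; apply: is_derive_dot.
  by apply: derivableP; exact: diff_derivable.
under eq_fun do rewrite -(derive_val (is_derive := dE _)).
apply: (measurable_avg_derive (f := fun z => dot (gradient q z) u)) => {}z.
  exact: measurable_dot_gradient.
by case: (dE z).
Qed.

(** The second difference of [q] is the quadratic form of its Hessian up to a
    bounded error. *)
Lemma averageable_hessian_form h :
  averageable (fun z => dot (h *m hessian q z) h).
Proof.
apply: (@averageable_near _ _ _ _ _ _ _
    (fun z => q (z + h) - q z + (q (z - h) - q z))
    (2 * (L * enorm h ^+ 3))) => [z||z].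
- exact: measurable_dot_hessian.
- by apply: averageableD; apply: averageableB => //; exact: averageable_shift.
have := hessian_lipschitz_taylor L_ge0 z h dq ddq lip.
have := hessian_lipschitz_taylor L_ge0 z (- h) dq ddq lip.
rewrite enormN mulNmx dotNl !dotNr opprK.
rewrite !ler_norml => /andP[? ?] /andP[? ?]; apply/andP; split; lra.
Qed.

(** Without a Lipschitz gradient the error in the first difference is not
    bounded; it becomes so once the quadratic term, integrable by
    [averageable_hessian_form], is removed. *)
Lemma averageable_gradient h : averageable (fun z => dot (gradient q z) h).
Proof.
apply: (@averageable_near _ _ _ _ _ _ _
    (fun z => q (z + h) - q z - 2^-1 * dot (h *m hessian q z) h)
    (L * enorm h ^+ 3)) => [z||z].
- exact: measurable_dot_gradient.
- apply: averageableB.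
    by apply: averageableB => //; exact: averageable_shift.
  by apply: averageableZ; exact: averageable_hessian_form.
- by rewrite distrC addrAC; exact: hessian_lipschitz_taylor.
Qed.

(** The linear term of a first difference of the gradient, up to a bounded
    error.  Polarizing [averageable_hessian_form] would need the symmetry of the
    Hessian. *)
Lemma averageable_hessian h u :
  averageable (fun z => dot (h *m hessian q z) u).
Proof.
apply: (@averageable_near _ _ _ _ _ _ _
    (fun z => dot (gradient q (z + h)) u - dot (gradient q z) u)
    (L * enorm h ^+ 2 * enorm u)) => [z||z].
- exact: measurable_dot_hessian.
- have gi := averageable_gradient u.
  apply: averageableB => //.
  exact: (averageable_shift (f := fun z => dot (gradient q z) u)).
- rewrite distrC -!dotBl; apply: le_trans (CauchySchwarz_dot _ _) _.
  rewrite ler_wpM2r ?enorm_ge0//; exact: jacobian_lipschitz_taylor.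
Qed.

(** In the averaged second-order expansion the quadratic term is itself
    [O(enorm h ^+ 2)], and so is the cubic error when [enorm h <= 1]. *)
Lemma avg_gradient z :
  differentiable (avg q : 'rV[R]_k -> R^o) z /\
  gradient (avg q) z = avgv (gradient q) z.
Proof.
set B := avgm (hessian q) z.
have B0 : 0 <= L + 2^-1 * `|opnorm B| by rewrite addr_ge0// mulr_ge0.
apply: (gradient_expansion B0) => h h1.
have gi := averageable_gradient; have Hi := averageable_hessian.
have qhi : averageable (fun y => q (y + h)) by exact: averageable_shift.
have dqi : averageable (fun y => q (y + h) - q y) by exact: averageableB.
have eqi : averageable (fun y => q (y + h) - q y - dot (gradient q y) h).
  exact: averageableB.
have hHi : averageable (fun y => 2^-1 * dot (h *m hessian q y) h).
  exact: averageableZ.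
have : `|avg q (z + h) - avg q z - dot (avgv (gradient q) z) h -
    2^-1 * dot (h *m B) h| <= L * enorm h ^+ 3.
  rewrite dot_avgv// dot_mul_avgm// -avg_shift -avgZ// -!avgB//.
  apply: normr_avg_le => [|y]; last exact: hessian_lipschitz_taylor.
  exact: averageableB.
set X := _ - dot _ h => XL.
rewrite -[X](subrK (2^-1 * dot (h *m B) h)) mulrDl.
apply: le_trans (ler_normD _ _) _; rewrite lerD//.
  by apply: le_trans XL _; rewrite ler_wpM2l// exprS ler_piMl// sqr_ge0.
rewrite normrM ger0_norm// -mulrA ler_wpM2l//.
apply: le_trans (CauchySchwarz_dot _ _) _.
rewrite expr2 mulrA ler_wpM2r ?enorm_ge0//.
apply: le_trans (enorm_mul_opnorm _ _) _.
by rewrite ler_wpM2r ?enorm_ge0// ler_norm.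
Qed.

Lemma avg_hessian z : differentiable (gradient (avg q)) z /\
  hessian (avg q) z = avgm (hessian q) z.
Proof.
have gE : gradient (avg q) = avgv (gradient q).
  by apply/funext => y; case: (avg_gradient y).
rewrite /hessian gE -/(hessian q); apply: (jacobian_expansion L_ge0) => h.
have gi := averageable_gradient; have Hi := averageable_hessian.
apply: enorm_le_dual => [|u]; first by rewrite mulr_ge0 ?sqr_ge0.
have ghi : averageable (fun y => dot (gradient q (y + h)) u).
  exact: (averageable_shift (f := fun y => dot (gradient q y) u)).
have ggi : averageable (fun y =>
    dot (gradient q (y + h)) u - dot (gradient q y) u).
  exact: averageableB.
have -> : dot (avgv (gradient q) (z + h) - avgv (gradient q) z -
      h *m avgm (hessian q) z) u =
    avg (fun y => dot (gradient q (y + h)) u - dot (gradient q y) u -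
      dot (h *m hessian q y) u) z.
  rewrite avgB// avgB// dotBl dotBl; congr (_ - _ - _).
  - rewrite dot_avgv; last exact: gi.
    by rewrite -[LHS](avg_shift P s (fun y => dot (gradient q y) u)).
  - by rewrite dot_avgv; last exact: gi.
  - by rewrite dot_mul_avgm; last exact: Hi.
apply: le_trans (ler_norm _) _.
apply: normr_avg_le => [|y].
  exact: averageableB ggi (Hi h u).
rewrite -!dotBl; apply: le_trans (CauchySchwarz_dot _ _) _.
rewrite ler_wpM2r ?enorm_ge0//; exact: jacobian_lipschitz_taylor.
Qed.

End lipschitz_hessian.
End differentiable_integrand.
End averaging_regularity.

(** * Gaussian smoothing as an average of translations *)

Section gaussian_smoothing.
Variables (R : realType) (n m : nat) (eta mu : R).
Implicit Types (q : 'rV[R]_(n + m) -> R) (z : 'rV[R]_(n + m)).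

Definition gaussian_shift
    (w : n.-tuple (measurableTypeR R) * m.-tuple (measurableTypeR R)) :
    'rV[R]_(n + m) :=
  row_mx (eta *: row_of_tuple w.1) (mu *: row_of_tuple w.2).

Lemma perturbedE q z : perturbed q eta mu z = fun w => q (z + gaussian_shift w).
Proof.
by apply/funext => w; rewrite /perturbed -[in RHS](hsubmxK z) add_row_mx.
Qed.

Lemma smoothedE q :
  smoothed q eta mu = avg (gaussian_pair R n m) gaussian_shift q.
Proof.
by apply/funext => z; rewrite /smoothed unlock perturbedE.
Qed.

Lemma averageable_smoothable q : smoothable q eta mu ->
  averageable (gaussian_pair R n m) gaussian_shift q.
Proof. by move=> qi z; rewrite -perturbedE; exact: qi. Qed.

End gaussian_smoothing.

(** In positive dimension two distinct points exist, so a Lipschitz constant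
    cannot be negative. *)
Lemma lipschitz_constant_ge0 (R : realType) (k : nat) (L : R)
    (D : 'rV[R]_k -> 'rV[R]_k -> R) : (0 < k)%N ->
  (forall z z', 0 <= D z z') ->
  (forall z z', D z z' <= L * enorm (z - z')) -> 0 <= L.
Proof.
case: k D => // k D _ D0 /(_ (const_mx 1) 0)/(le_trans (D0 _ _)).
rewrite pmulr_lge0// lt_def enorm_ge0 andbT subr0.
apply: contra_neq (oner_neq0 R) => z0.
have := normr_le_enorm (const_mx 1 : 'rV[R]_k.+1); rewrite z0 normr_le0.
by move=> /eqP/rowP/(_ ord0); rewrite !mxE.
Qed.

Theorem proposition2p1 (R : realType) (n m : nat) (n_ge1 : (1 <= n)%N)
    (m_ge1 : (1 <= m)%N) (q : 'rV[R]_(n + m) -> R) (eta mu : R)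
    (eta_ge0 : 0 <= eta) (mu_ge0 : 0 <= mu) (q_smoothable : smoothable q eta mu) :
  [/\ convex_function [set: convex_lmodType 'rV[R]_(n + m)] q ->
      convex_function [set: convex_lmodType 'rV[R]_(n + m)] (smoothed q eta mu),
      forall lambda : R, strongly_convex lambda q ->
        strongly_convex lambda (smoothed q eta mu)
    & forall (i : 'I_3) (L : R), smooth_class i L q ->
        smooth_class i L (smoothed q eta mu)].
Proof.
have qi : averageable (gaussian_pair R n m) (@gaussian_shift R n m eta mu) q.
  exact: averageable_smoothable q_smoothable.
rewrite smoothedE.
have k_gt0 : (0 < n + m)%N by rewrite addn_gt0 n_ge1.
split=> [qc t x y _ _|lambda qc x y t t01|i L].
- have := @avg_convex _ _ _ _ _ _ q t%:num 0 x y qi.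
  rewrite subr0; apply => z; rewrite subr0.
  by apply: (qc t (x + z) (y + z)); rewrite inE.
- apply: avg_convex => [|z]; first exact: qi.
  apply: le_trans (qc _ _ _ t01) _.
  by rewrite opprD addrACA subrr addr0.
case: i => -[|[|j]] i_lt3; rewrite /smooth_class /=.
- exact: avg_lipschitz.
- move=> [dq lip].
  have L0 : 0 <= L.
    by apply: lipschitz_constant_ge0 lip => // *; exact: enorm_ge0.
  have dE := avg_lipschitz_gradient L0 qi dq lip.
  split=> [z|z z']; first by case: (dE z).
  rewrite (dE z).2 (dE z').2; apply: avgv_lipschitz => //.
  exact: (averageable_lipschitz_gradient L0).
- move=> [dq [ddq lip]].
  have L0 : 0 <= L.
    by apply: lipschitz_constant_ge0 lip => // *; exact: opnorm_ge0.
  have gE := avg_gradient L0 qi dq ddq lip.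
  have hE := avg_hessian L0 qi dq ddq lip.
  split=> [z|]; first by case: (gE z).
  split=> [z|z z']; first by case: (hE z).
  rewrite (hE z).2 (hE z').2; apply: avgm_lipschitz => // u v.
  exact: (averageable_hessian L0).
Qed.
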